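(* Let $\alpha,\beta,\gamma,\delta\in\mathbb{R}$ with $\alpha+\delta\neq0$ and $\alpha\gamma+\beta\delta=0$, and let $G_5$ be the connected, simply connected three-dimensional Lie group with left-invariant Lorentzian metric $g$ whose Lie algebra has a pseudo-orthonormal basis $\{\widetilde e_1,\widetilde e_2,\widetilde e_3\}$, with $\widetilde e_3$ timelike, satisfying $$[\widetilde e_1,\widetilde e_2]=0,\quad [\widetilde e_1,\widetilde e_3]=\alpha\widetilde e_1+\beta\widetilde e_2,\quad [\widetilde e_2,\widetilde e_3]=\gamma\widetilde e_1+\delta\widetilde e_2.$$ Let $\nabla^B$ be the Bott connection and $\widetilde\rho^B$ its symmetrized Ricci tensor. Then $(G_5,\nabla^B,\widetilde\rho^B)$ is a quasi-statistical structure.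
   Context: Basis vectors are identified with left-invariant vector fields on the group $G$; $g(\widetilde e_1,\widetilde e_1)=g(\widetilde e_2,\widetilde e_2)=1$, $g(\widetilde e_3,\widetilde e_3)=-1$, and $g(\widetilde e_i,\widetilde e_j)=0$ for $i\ne j$. Let $\nabla^L$ be the Levi-Civita connection of $g$, $D=\mathrm{span}\{\widetilde e_1,\widetilde e_2\}$, $D^\perp=\mathrm{span}\{\widetilde e_3\}$ (distributions on $G$), with associated projections $\pi_D,\pi_{D^\perp}$ of $TG=D\oplus D^\perp$. The Bott connection $\nabla^B$ is the linear connection given by: $\nabla^B_XY=\pi_D(\nabla^L_XY)$ for $X,Y\in\Gamma^\infty(D)$; $\nabla^B_XY=\pi_D([X,Y])$ for $X\in\Gamma^\infty(D^\perp),Y\in\Gamma^\infty(D)$; $\nabla^B_XY=\pi_{D^\perp}([X,Y])$ for $X\in\Gamma^\infty(D),Y\in\Gamma^\infty(D^\perp)$; $\nabla^B_XY=\pi_{D^\perp}(\nabla^L_XY)$ for $X,Y\in\Gamma^\infty(D^\perp)$. Curvature: $R^B(X,Y)Z=\nabla^B_X\nabla^B_YZ-\nabla^B_Y\nabla^B_XZ-\nabla^B_{[X,Y]}Z$. Ricci tensor: $\rho^B(X,Y)=-g(R^B(X,\widetilde e_1)Y,\widetilde e_1)-g(R^B(X,\widetilde e_2)Y,\widetilde e_2)+g(R^B(X,\widetilde e_3)Y,\widetilde e_3)$. Symmetrized Ricci tensor: $\widetilde\rho^B(X,Y)=\tfrac12(\rho^B(X,Y)+\rho^B(Y,X))$.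 For a linear connection $\nabla$ with torsion $T(X,Y)=\nabla_XY-\nabla_YX-[X,Y]$ and a $(0,2)$ tensor field $\omega$, put $(\nabla_X\omega)(Y,Z)=X[\omega(Y,Z)]-\omega(\nabla_XY,Z)-\omega(Y,\nabla_XZ)$. The triple $(G,\nabla,\omega)$ is called a quasi-statistical structure if $(\nabla_X\omega)(Y,Z)-(\nabla_Y\omega)(X,Z)+\omega(T(X,Y),Z)=0$ for all vector fields $X,Y,Z$. *)

(* Defs.v *)
From HB Require Import structures.
From mathcomp Require Import all_boot all_order all_algebra.
From mathcomp Require Import all_classical all_reals all_analysis.

Set Implicit Arguments.
Unset Strict Implicit.
Unset Printing Implicit Defensive.

Import Order.TTheory GRing.Theory Num.Theory.
Import numFieldNormedType.Exports.

Local Open Scope classical_set_scope.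
Local Open Scope ring_scope.

(** ** Smooth maps between open sets of finite-dimensional normed spaces *)

(* [diff_class k U f]: f is k times Frechet differentiable on the open set U,
   with k-th iterated directional derivatives continuous on U.  In finite
   dimension, the conjunction over all k is the usual C^oo. *)
Fixpoint diff_class (R : realType) (V W : normedModType R) (k : nat)
    (U : set V) (f : V -> W) : Prop :=
  match k with
  | 0%N => forall x, U x -> {for x, continuous f}
  | k'.+1 => (forall x, U x -> differentiable f x) /\
             (forall v : V, diff_class k' U (fun x => 'D_v f x))
  end.

Definition smooth_on (R : realType) (V W : normedModType R)
    (U : set V) (f : V -> W) : Prop :=
  forall k, diff_class k U f.

(** ** Manifolds and Lie groups modelled on a finite-dimensional space V *)

(* [coord] is only meaningful on [dom], and [param], its inverse, on
   [img = coord @` dom]. *)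
Record chart (R : realType) (V : normedModType R) (M : topologicalType) :=
  Chart { dom : set M; coord : M -> V; param : V -> M }.

Definition img (R : realType) (V : normedModType R) (M : topologicalType)
    (c : chart V M) : set V := coord c @` dom c.

Definition is_chart (R : realType) (V : normedModType R) (M : topologicalType)
    (c : chart V M) : Prop :=
  [/\ open (dom c), open (img c),
      forall p, dom c p -> param c (coord c p) = p,
      forall p, dom c p -> {for p, continuous (coord c)} &
      forall x, img c x -> {for x, continuous (param c)}].

Record manifold (R : realType) (V : normedModType R) := Manifold {
  space :> topologicalType;
  atlas : set (chart V space);
  man_hausdorff : hausdorff_space space;
  man_countable : @second_countable space;
  man_chart : forall c, atlas c -> is_chart c;
  man_cover : forall p, exists2 c, atlas c & dom c p;
  man_transition : forall c d, atlas c -> atlas d ->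
    smooth_on (coord c @` (dom c `&` dom d)) (coord d \o param c)
}.

Definition simply_connected (R : realType) (T : topologicalType) : Prop :=
  forall gam : R -> T, {within `[0, 1], continuous gam} -> gam 0 = gam 1 ->
  exists H : R * R -> T,
    [/\ {within `[0, 1] `*` `[0, 1], continuous H},
        forall t, t \in `[0, 1] -> H (0, t) = gam t,
        forall t, t \in `[0, 1] -> H (1, t) = gam 0 &
        forall s, s \in `[0, 1] -> H (s, 0) = gam 0 /\ H (s, 1) = gam 0].

Record lieGroup (R : realType) (V : normedModType R) := LieGroup {
  lg_manifold :> manifold V;
  lg_mul : lg_manifold -> lg_manifold -> lg_manifold;
  lg_one : lg_manifold;
  lg_inv : lg_manifold -> lg_manifold;
  lg_mulA : associative lg_mul;
  lg_mul1 : left_id lg_one lg_mul;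
  lg_mulV : left_inverse lg_one lg_inv lg_mul;
  lg_mul_continuous :
    continuous (fun pq : lg_manifold * lg_manifold => lg_mul pq.1 pq.2);
  lg_mul_smooth : forall c c' d : chart V lg_manifold,
    atlas c -> atlas c' -> atlas d ->
    smooth_on [set xy : V * V | [/\ img c xy.1, img c' xy.2 &
                                    dom d (lg_mul (param c xy.1) (param c' xy.2))]]
              (fun xy => coord d (lg_mul (param c xy.1) (param c' xy.2)));
  lg_inv_continuous : continuous lg_inv;
  lg_inv_smooth : forall c d : chart V lg_manifold, atlas c -> atlas d ->
    smooth_on [set x | img c x /\ dom d (lg_inv (param c x))]
              (fun x => coord d (lg_inv (param c x)))
}.

(** ** Vector fields *)

Definition smooth_fun (R : realType) (V : normedModType R) (M : manifold V)
    (f : M -> R) : Prop :=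
  forall c, atlas c -> smooth_on (img c) (f \o param c).

(* Vector fields are represented by their action on functions; sums and
   real multiples are the pointwise ones. *)
Definition operator (R : realType) (V : normedModType R) (M : manifold V) : Type :=
  (M -> R) -> (M -> R).

(* In each chart, X is [sum_i a^i d/dx^i] with smooth components [a].  Setting
   X to 0 off the smooth functions makes equality of operators coincide with
   equality of vector fields. *)
Definition vector_field (R : realType) (V : normedModType R) (M : manifold V)
    (X : operator M) : Prop :=
  (forall f, ~ smooth_fun f -> X f = 0) /\
  (forall c, atlas c -> exists2 a : V -> V, smooth_on (img c) a &
     forall f, smooth_fun f -> forall p, dom c p ->
       X f p = 'D_(a (coord c p)) (f \o param c) (coord c p)).

Definition fscale (R : realType) (V : normedModType R) (M : manifold V)
    (f : M -> R) (X : operator M) : operator M :=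
  fun h => f * X h.

Definition lie_bracket (R : realType) (V : normedModType R) (M : manifold V)
    (X Y : operator M) : operator M :=
  fun f => X (Y f) - Y (X f).

Definition left_invariant (R : realType) (V : normedModType R) (G : lieGroup V)
    (X : operator G) : Prop :=
  forall (a : G) (f : G -> R), smooth_fun f ->
    X (f \o lg_mul a) = X f \o lg_mul a.

(* The Lie algebra of G is the space of left-invariant vector fields. *)
Definition lie_algebra_basis (R : realType) (V : normedModType R)
    (G : lieGroup V) (e1 e2 e3 : operator G) : Prop :=
  [/\ vector_field e1 /\ left_invariant e1,
      vector_field e2 /\ left_invariant e2,
      vector_field e3 /\ left_invariant e3 &
      forall X, vector_field X -> left_invariant X ->
        exists! abc : R * R * R,
          X = abc.1.1 *: e1 + abc.1.2 *: e2 + abc.2 *: e3].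

(** ** Tensor fields of type (0,2) and Lorentzian metrics *)

Definition form2 (R : realType) (V : normedModType R) (M : manifold V) : Type :=
  operator M -> operator M -> (M -> R).

(* Tensor fields are the C^oo(M)-bilinear maps on vector fields. *)
Definition tensor02 (R : realType) (V : normedModType R) (M : manifold V)
    (w : form2 M) : Prop :=
  (forall X Y, vector_field X -> vector_field Y -> smooth_fun (w X Y)) /\
  (forall f X X' Y, smooth_fun f -> vector_field X -> vector_field X' ->
     vector_field Y ->
     w (fscale f X + X') Y = f * w X Y + w X' Y /\
     w Y (fscale f X + X') = f * w Y X + w Y X').

Definition lorentzian_metric (R : realType) (n : nat)
    (M : manifold 'rV[R]_n.+1) (g : form2 M) : Prop :=
  [/\ tensor02 g,
      forall X Y, vector_field X -> vector_field Y -> g X Y = g Y X &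
      forall p, exists v : 'I_n.+1 -> operator M,
        [/\ forall i, vector_field (v i),
            forall X, vector_field X -> exists a : 'I_n.+1 -> R,
              forall f, smooth_fun f -> X f p = \sum_i a i * v i f p &
            forall i j, g (v i) (v j) p =
              if i == j then (if i == ord_max then -1 else 1) else 0]].

Definition push_left (R : realType) (V : normedModType R) (G : lieGroup V)
    (a : G) (X : operator G) : operator G :=
  fun f => X (f \o lg_mul a) \o lg_mul (lg_inv a).

Definition left_invariant_metric (R : realType) (V : normedModType R)
    (G : lieGroup V) (g : form2 G) : Prop :=
  forall (a : G) X Y, vector_field X -> vector_field Y ->
    g (push_left a X) (push_left a Y) \o lg_mul a = g X Y.

(** ** Linear connections *)

Definition connection (R : realType) (V : normedModType R) (M : manifold V)
    : Type :=
  operator M -> operator M -> operator M.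

Definition linear_connection (R : realType) (V : normedModType R)
    (M : manifold V) (nabla : connection M) : Prop :=
  [/\ forall X Y, vector_field X -> vector_field Y -> vector_field (nabla X Y),
      forall f X X' Y, smooth_fun f -> vector_field X -> vector_field X' ->
        vector_field Y ->
        nabla (fscale f X + X') Y = fscale f (nabla X Y) + nabla X' Y,
      forall X Y Y', vector_field X -> vector_field Y -> vector_field Y' ->
        nabla X (Y + Y') = nabla X Y + nabla X Y' &
      forall f X Y, smooth_fun f -> vector_field X -> vector_field Y ->
        nabla X (fscale f Y) = fscale (X f) Y + fscale f (nabla X Y)].

Definition torsion (R : realType) (V : normedModType R) (M : manifold V)
    (nabla : connection M) (X Y : operator M) : operator M :=
  nabla X Y - nabla Y X - lie_bracket X Y.

Definition curvature (R : realType) (V : normedModType R) (M : manifold V)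
    (nabla : connection M) (X Y Z : operator M) : operator M :=
  nabla X (nabla Y Z) - nabla Y (nabla X Z) - nabla (lie_bracket X Y) Z.

Definition cov_deriv (R : realType) (V : normedModType R) (M : manifold V)
    (nabla : connection M) (w : form2 M) (X Y Z : operator M) : M -> R :=
  X (w Y Z) - w (nabla X Y) Z - w Y (nabla X Z).

Definition levi_civita (R : realType) (V : normedModType R) (M : manifold V)
    (g : form2 M) (nabla : connection M) : Prop :=
  [/\ linear_connection nabla,
      forall X Y, vector_field X -> vector_field Y -> torsion nabla X Y = 0 &
      forall X Y Z, vector_field X -> vector_field Y -> vector_field Z ->
        cov_deriv nabla g X Y Z = 0].

(** ** Distributions and the Bott connection *)

(* Smooth sections of the distribution spanned, at each point, by the values
   of the fields in E. *)
Definition sections (R : realType) (V : normedModType R) (M : manifold V)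
    (E : seq (operator M)) (X : operator M) : Prop :=
  vector_field X /\
  forall p, exists a : nat -> R, forall f, smooth_fun f ->
    X f p = \sum_(i < size E) a i * (E`_i f p).

Definition splitting_projections (R : realType) (V : normedModType R)
    (M : manifold V) (D D' : seq (operator M))
    (pi pi' : operator M -> operator M) : Prop :=
  forall X, vector_field X ->
    [/\ sections D (pi X), sections D' (pi' X) & X = pi X + pi' X].

Definition bott_connection (R : realType) (V : normedModType R)
    (M : manifold V) (D D' : seq (operator M))
    (pi pi' : operator M -> operator M) (nablaL nabla : connection M) : Prop :=
  linear_connection nabla /\
  [/\ forall X Y, sections D X -> sections D Y -> nabla X Y = pi (nablaL X Y),
      forall X Y, sections D' X -> sections D Y ->
        nabla X Y = pi (lie_bracket X Y),
      forall X Y, sections D X -> sections D' Y ->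
        nabla X Y = pi' (lie_bracket X Y) &
      forall X Y, sections D' X -> sections D' Y ->
        nabla X Y = pi' (nablaL X Y)].

(** ** Ricci tensors and quasi-statistical structures *)

(* The trace of [Z |-> curvature nabla Z X Y] in a pseudo-orthonormal frame
   with e3 timelike. *)
Definition ricci (R : realType) (V : normedModType R) (M : manifold V)
    (g : form2 M) (e1 e2 e3 : operator M) (nabla : connection M) : form2 M :=
  fun X Y => - g (curvature nabla X e1 Y) e1 - g (curvature nabla X e2 Y) e2
             + g (curvature nabla X e3 Y) e3.

Definition sym_ricci (R : realType) (V : normedModType R) (M : manifold V)
    (g : form2 M) (e1 e2 e3 : operator M) (nabla : connection M) : form2 M :=
  fun X Y => (2^-1 : R) *: (ricci g e1 e2 e3 nabla X Y + ricci g e1 e2 e3 nabla Y X).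

Definition quasi_statistical (R : realType) (V : normedModType R)
    (M : manifold V) (nabla : connection M) (w : form2 M) : Prop :=
  [/\ linear_connection nabla, tensor02 w &
      forall X Y Z, vector_field X -> vector_field Y -> vector_field Z ->
        cov_deriv nabla w X Y Z - cov_deriv nabla w Y X Z
        + w (torsion nabla X Y) Z = 0].

(* Main.v *)
Require Import Defs.
From HB Require Import structures.
From mathcomp Require Import all_boot all_order all_algebra.
From mathcomp Require Import all_classical all_reals all_analysis.
From mathcomp Require Import ring.
Import Order.TTheory GRing.Theory Num.Theory.
Import numFieldNormedType.Exports.
Local Open Scope classical_set_scope.
Local Open Scope ring_scope.

(** The Bott connection of this group is flat, so its Ricci tensor vanishes and
    the three terms of the quasi-statistical identity are all zero.

    Flatness is a computation in the left-invariant frame.  As [e1, e2] = 0,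
    the Koszul relations (the Levi-Civita connection is metric and
    torsion-free, and the frame has constant products) make the leaf
    directions parallel along the leaves: pi_D (nablaL_ei ej) = 0 for
    i, j <= 2.  The brackets [ei, e3] lie in D, so nablaB_ei e3 = 0 as well,
    and nablaB_e3 maps the frame into constant combinations of e1 and e2.
    Hence each term of R(ei, e3) ek is zero: the first differentiates a
    constant combination of e1, e2 along a leaf, the second differentiates
    nablaB_ei ek = 0, and the third differentiates ek along [ei, e3], which is
    a leaf direction.  Finally R(e1, e2) ek = 0 because e1 and e2 commute
    ([bott_leaf], [bott_transverse], [bott_curvature_frame]).

    To pass from the frame to all vector fields ([bott_flat]) one needs that
    every vector field is a combination of e1, e2, e3 with smooth
    coefficients, namely its products with the frame, with a sign for the
    timelike e3 ([frame_expansion]).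
    The projections only give coefficients pointwise; that they are these
    products is the statement that a map linear over smooth
    functions depends on the value of its argument at one point only.  The
    usual proof uses bump functions.  Here [function_linear_vanish] instead
    eliminates the frame fields one at a time, which only needs the frame to
    be independent, at each point, as functionals on globally smooth
    functions; this independence follows from left invariance, since a
    left-invariant field that kills all smooth functions at one point is zero
    ([left_invariant_eq0]).

    The analysis reduces to closure properties: smooth functions form a ring,
    vector fields a module over it, and vector fields act on smooth functions
    as derivations.  Brackets are vector fields because the Levi-Civita
    connection is torsion-free: [X, Y] = nablaL_X Y - nablaL_Y X. *)

Set Implicit Arguments.
Unset Strict Implicit.
Unset Printing Implicit Defensive.

(** * Smooth maps on open sets *)

(** [diff_class] constrains the iterated derivatives on an open set only, and
    the product and chain rules hold only there, so differentiability must be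
    transported along local equality. *)
Lemma near_eq_differentiable {R : numFieldType} {V W : normedModType R}
    (f g : V -> W) (x : V) :
  (\forall y \near x, f y = g y) -> differentiable f x -> differentiable g x.
Proof.
move=> fg df; have fgx : f x = g x by exact: nbhs_singleton fg.
have Eg : g \o shift x = cst (g x) + 'd f x +o_ 0 id.
  apply/eqaddoP => _/posnumP[eps].
  have /eqaddoP/(_ _ (gt0 eps)) := diff_locally df.
  have fg0 : \forall y \near (0 : V), f (y + x) = g (y + x).
    by rewrite (near_shift x) sub0r; near do rewrite /= subrK.
  apply: filter_app; near=> y.
  have /= fgy : f (y + x) = g (y + x) by near: y.
  by rewrite -fgx /= !fctE /= fgy.
have cf : continuous ('d f x) by exact: diff_continuous.
by apply/diff_locallyP; rewrite (diff_unique cf Eg).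
Unshelve. all: by end_near.
Qed.

Section SmoothMaps.
Context {R : realType} {V W : normedModType R}.
Implicit Types (U : set V) (f g : V -> W) (k : V -> R) (n : nat).

Lemma diff_class_ext n U f g : open U -> (forall x, U x -> f x = g x) ->
  diff_class n U f -> diff_class n U g.
Proof.
move=> oU; elim: n f g => [|n IHn] f g fg /=.
  move=> cf x Ux; have fgn : \forall y \near x, f y = g y.
    by apply: filterS (open_nbhs_nbhs (conj oU Ux)) => y; exact: fg.
  have cfx : f y @[y --> x] --> g x by rewrite -(fg x Ux); exact: cf.
  exact: cvg_trans (near_eq_cvg fgn) cfx.
move=> [df Df]; have fgn x : U x -> \forall y \near x, f y = g y.
  by move=> Ux; apply: filterS (open_nbhs_nbhs (conj oU Ux)) => y; exact: fg.
split=> [x Ux|v]; first by apply: near_eq_differentiable (fgn x Ux) (df x Ux).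
by apply: IHn (Df v) => x Ux; apply: near_eq_derive; exact: fgn.
Qed.

Lemma diff_classW n U f : diff_class n.+1 U f -> diff_class n U f.
Proof.
elim: n f => [|n IHn] f [df Df].
  by move=> x Ux; apply: differentiable_continuous; exact: df.
by split=> // v; apply: IHn.
Qed.

Lemma diff_class_cst n U (w : W) : diff_class n U (cst w).
Proof.
elim: n w => [|n IHn] w /=; first by move=> x _; exact: cst_continuous.
split=> [x _|v]; first exact: differentiable_cst.
rewrite (_ : (fun x => _) = cst 0); first exact: IHn.
by apply/funext => x; rewrite derive_cst.
Qed.

Lemma diff_classD n U f g : open U ->
  diff_class n U f -> diff_class n U g -> diff_class n U (f + g).
Proof.
move=> oU; elim: n f g => [|n IHn] f g /=.
  by move=> cf cg x Ux; apply: continuousD; [exact: cf|exact: cg].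
move=> [df Df] [dg Dg]; split=> [x Ux|v].
  by apply: differentiableD; [exact: df|exact: dg].
apply: diff_class_ext oU _ (IHn _ _ (Df v) (Dg v)) => x Ux.
by rewrite deriveD//; apply: diff_derivable; [exact: df|exact: dg].
Qed.

End SmoothMaps.

Section SmoothScaling.
Context {R : realType} {V W : normedModType R}.
Implicit Types (U : set V) (f : V -> W) (k : V -> R) (n : nat).

(** The product rule for a scalar function times a vector-valued one is the
    derivative of this continuous bilinear map, composed with a pair. *)
Lemma scale_is_bilinear : bilinear_for
  (GRing.Scale.Law.clone _ _ *:%R _) (GRing.Scale.Law.clone _ _ *:%R _)
  (@GRing.scale R W).
Proof.
split=> [w|r] a x y /=; first by rewrite scalerDl scalerA.
by rewrite scalerDr !scalerA mulrC.
Qed.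

Lemma is_diff_scale k f x : differentiable k x -> differentiable f x ->
  is_diff x (fun y => k y *: f y) (fun v => k x *: 'd f x v + 'd k x v *: f x).
Proof.
move=> dk df.
pose mS := bilinear_isBilinear.Build R R W W _ _ _ scale_is_bilinear.
pose s : {bilinear R -> W -> W} := HB.pack (@GRing.scale R W) mS.
have cs : continuous (fun p : R * W => s p.1 p.2) by exact: scale_continuous.
have ds : is_diff (k x, f x) (fun p : R * W => s p.1 p.2)
    (fun q : R * W => s (k x) q.2 + s q.1 (f x)).
  by apply: DiffDef; [exact: differentiable_bilin|rewrite diff_bilin].
have dkf : is_diff x (fun y => (k y, f y)) (fun v => ('d k x v, 'd f x v)).
  by apply: is_diff_pair; exact: differentiableP.
exact: (is_diff_comp dkf ds).
Qed.

Lemma diff_classZ n U k f : open U ->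
  diff_class n U k -> diff_class n U f -> diff_class n U (fun x => k x *: f x).
Proof.
move=> oU; elim: n k f => [|n IHn] k f.
  by move=> ck cf x Ux; apply: continuousZ; [exact: ck|exact: cf].
move=> Ck Cf; have [dk Dk] := Ck; have [df Df] := Cf.
split=> [x Ux|v].
  have dkx := is_diff_scale (dk x Ux) (df x Ux).
  exact: ex_diff.
have C := diff_classD oU (IHn _ _ (diff_classW Ck) (Df v))
                         (IHn _ _ (Dk v) (diff_classW Cf)).
apply: diff_class_ext oU _ C => x Ux.
have dkx := is_diff_scale (dk x Ux) (df x Ux).
by rewrite fctE /= !deriveE ?diff_val //; [exact: dk|exact: df].
Qed.

End SmoothScaling.

Section RowVectors.
Context {R : realType} {n : nat}.
Local Notation V := 'rV[R]_n.+1.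
Implicit Types (U : set V) (k : nat).

Lemma diff_class_linear k U (W W' : normedModType R) (L : {linear W -> W'})
    (a : V -> W) :
  continuous L -> open U -> diff_class k U a -> diff_class k U (L \o a).
Proof.
move=> cL oU; elim: k a => [|k IHk] a /=.
  by move=> ca x Ux; apply: continuous_comp; [exact: ca|exact: cL].
move=> [da Da]; split=> [x Ux|v].
  by apply: differentiable_comp; [exact: da|exact: linear_differentiable].
apply: diff_class_ext oU _ (IHk _ (Da v)) => x Ux /=.
have dL : differentiable L (a x) by exact: linear_differentiable.
rewrite deriveE; last exact: da.
rewrite deriveE; last by apply: differentiable_comp dL; exact: da.
by rewrite (diff_comp (da x Ux) dL) /= diff_lin.
Qed.

(** The direction [a x] varies, so ['D_(a x) F x] is not itself an iterated
    directional derivative of [F]: it is expanded on the standard basis as a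
    sum of products of components of [a] and partial derivatives of [F]. *)
Lemma diff_class_derive_along k U (a : V -> V) (F : V -> R) : open U ->
  diff_class k U a -> diff_class k.+1 U F ->
  diff_class k U (fun x => 'D_(a x) F x).
Proof.
move=> oU sa [dF DF].
(* Summing over a list makes the induction on the terms possible. *)
have C (s : seq 'I_n.+1) : diff_class k U
    (fun x => \sum_(i <- s) a x ord0 i * 'D_(delta_mx ord0 i) F x).
  elim: s => [|i s IHs].
    under eq_fun do rewrite big_nil; exact: (@diff_class_cst _ _ _ _ _ (0 : R)).
  under eq_fun do rewrite big_cons; apply: diff_classD => //.
  apply: (@diff_classZ _ _ _ _ _ (fun x => a x ord0 i)) => //; last exact: DF.
  have cL : continuous (fun v : V => v ord0 i) by exact: coord_continuous.
  have lL : linear (fun v : V => v ord0 i) by move=> r u v; rewrite !mxE.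
  pose mL := GRing.isLinear.Build _ _ _ _ _ lL.
  pose L : {linear V -> R} := HB.pack (fun v : V => v ord0 i) mL.
  exact: (@diff_class_linear k U _ _ L).
apply: diff_class_ext oU _ (C (index_enum _)) => x Ux.
rewrite deriveE; last exact: dF.
rewrite {2}[a x]row_sum_delta linear_sum; apply: eq_bigr => i _.
by rewrite linearZ /= deriveE //; exact: dF.
Qed.

End RowVectors.

(** * Smooth functions and vector fields *)

Section Manifolds.
Context {R : realType} {V : normedModType R} {M : manifold V}.
Implicit Types (f h : M -> R) (X Y : operator M).

Lemma open_img (c : chart V M) : atlas c -> open (img c).
Proof. by move=> /man_chart[]. Qed.

Lemma param_coord (c : chart V M) p : atlas c -> dom c p ->
  param c (Defs.coord c p) = p.
Proof. by move=> /man_chart[_ _ + _ _] => /[apply]. Qed.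

Lemma img_coord (c : chart V M) p : dom c p -> img c (Defs.coord c p).
Proof. by exists p. Qed.

Lemma smooth_fun_cst (r : R) : @smooth_fun R V M (cst r).
Proof. by move=> c _ n; exact: diff_class_cst. Qed.

Lemma smooth_funD f h : smooth_fun f -> smooth_fun h -> smooth_fun (f + h).
Proof.
move=> sf sh c Ac n; apply: diff_classD; first exact: open_img.
  exact: sf.
exact: sh.
Qed.

Lemma smooth_funM f h : smooth_fun f -> smooth_fun h -> smooth_fun (f * h).
Proof.
move=> sf sh c Ac n.
by apply: diff_classZ; [exact: open_img|exact: sf|exact: sh].
Qed.

Lemma smooth_funN f : smooth_fun f -> smooth_fun (- f).
Proof.
move=> sf; rewrite (_ : - f = cst (-1) * f); last first.
  by apply/funext => x; rewrite /= mulN1r.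
by apply: smooth_funM => //; exact: smooth_fun_cst.
Qed.

Lemma smooth_fun_differentiable f (c : chart V M) p :
  smooth_fun f -> atlas c -> dom c p ->
  differentiable (f \o param c) (Defs.coord c p).
Proof.
by move=> sf Ac cp; have [+ _] := sf c Ac 1%N; apply; exact: img_coord.
Qed.

(** Both fields vanish off the smooth functions, so agreement on smooth
    functions is equality. *)
Lemma vector_field_eq X Y : vector_field X -> vector_field Y ->
  (forall f, smooth_fun f -> forall p, X f p = Y f p) -> X = Y.
Proof.
move=> [X0 _] [Y0 _] XY; apply/funext => f.
have [sf|nsf] := pselect (smooth_fun f); last by rewrite X0 ?Y0.
by apply/funext => p; exact: XY.
Qed.

Lemma vector_field0 : vector_field (0 : operator M).
Proof.
split=> // c Ac; exists (cst 0); first by move=> n; exact: diff_class_cst.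
by move=> f _ p _; rewrite derive0.
Qed.

Lemma fscaleDE f X Y h p : (fscale f X + Y) h p = f p * X h p + Y h p.
Proof. by []. Qed.

Lemma vector_fieldZD f X Y : smooth_fun f -> vector_field X ->
  vector_field Y -> vector_field (fscale f X + Y).
Proof.
move=> sf [X0 cX] [Y0 cY]; split=> [h nsh|c Ac].
  by apply/funext => p; rewrite fscaleDE X0// Y0// [LHS]addr0; exact: mulr0.
have [a sa aE] := cX c Ac; have [b sb bE] := cY c Ac.
exists ((fun x => (f \o param c) x *: a x) + b).
  move=> n; apply: diff_classD; [exact: open_img| |exact: sb].
  by apply: diff_classZ; [exact: open_img|exact: sf|exact: sa].
move=> h sh p cp; have dh := smooth_fun_differentiable sh Ac cp.
rewrite fscaleDE aE // bE // !deriveE //.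
by rewrite linearD linearZ /= param_coord.
Qed.

Lemma fscale0 f : fscale f (0 : operator M) = 0.
Proof. by apply/funext => h; apply/funext => p; exact: mulr0. Qed.

Lemma fscale1 X : fscale (cst 1) X = X.
Proof. by apply/funext => h; apply/funext => p; exact: mul1r. Qed.

Lemma fscale_cst (r : R) X : fscale (cst r) X = r *: X.
Proof. by []. Qed.

Lemma vector_fieldD X Y : vector_field X -> vector_field Y ->
  vector_field (X + Y).
Proof.
move=> vX vY; rewrite -[X]fscale1.
by apply: vector_fieldZD => //; exact: smooth_fun_cst.
Qed.

Lemma vector_field_fscale f X : smooth_fun f -> vector_field X ->
  vector_field (fscale f X).
Proof.
move=> sf vX; rewrite -[fscale f X]addr0.
by apply: vector_fieldZD => //; exact: vector_field0.
Qed.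

Lemma vector_fieldZ (r : R) X : vector_field X -> vector_field (r *: X).
Proof.
by move=> vX; apply: vector_field_fscale => //; exact: smooth_fun_cst.
Qed.

Lemma vector_fieldN X : vector_field X -> vector_field (- X).
Proof. by move=> vX; rewrite -scaleN1r; exact: vector_fieldZ. Qed.

Lemma vector_fieldB X Y : vector_field X -> vector_field Y ->
  vector_field (X - Y).
Proof. by move=> vX vY; apply: vector_fieldD => //; exact: vector_fieldN. Qed.

Lemma vector_field_sum n (X : nat -> operator M) (f : nat -> M -> R) :
  (forall i, (i < n)%N -> vector_field (X i)) ->
  (forall i, (i < n)%N -> smooth_fun (f i)) ->
  vector_field (\sum_(i < n) fscale (f i) (X i)).
Proof.
elim: n => [|n IHn] vX sf; first by rewrite big_ord0; exact: vector_field0.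
rewrite big_ord_recr /= addrC; apply: vector_fieldZD; [exact: sf|exact: vX|].
by apply: IHn => i /ltnW ltin; [apply: vX|apply: sf].
Qed.

End Manifolds.

Section Derivations.
Context {R : realType} {V : normedModType R} {M : manifold V}.
Implicit Types (f h : M -> R) (X : operator M).

Lemma vector_field_addf X f h : vector_field X -> smooth_fun f ->
  smooth_fun h -> X (f + h) = X f + X h.
Proof.
move=> [_ cX] sf sh; apply/funext => p; have [c Ac cp] := man_cover p.
have [a _ aE] := cX c Ac; have [df dh] := (smooth_fun_differentiable sf Ac cp,
  smooth_fun_differentiable sh Ac cp).
rewrite [RHS]/= !fctE !aE //; last exact: smooth_funD.
rewrite (_ : (f + h) \o param c = (f \o param c) + (h \o param c)) //.
by rewrite deriveD //; exact: diff_derivable.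
Qed.

Lemma vector_field_mulf X f h : vector_field X -> smooth_fun f ->
  smooth_fun h -> X (f * h) = X f * h + f * X h.
Proof.
move=> [_ cX] sf sh; apply/funext => p; have [c Ac cp] := man_cover p.
have [a _ aE] := cX c Ac; have [df dh] := (smooth_fun_differentiable sf Ac cp,
  smooth_fun_differentiable sh Ac cp).
rewrite [RHS]/= !fctE !aE //; last exact: smooth_funM.
rewrite (_ : (f * h) \o param c = (f \o param c) * (h \o param c)) //.
rewrite deriveM; [|exact: diff_derivable|exact: diff_derivable].
by rewrite /= param_coord // addrC [h p *: _]mulrC.
Qed.

Lemma vector_field_cstf X r : vector_field X -> X (cst r) = 0.
Proof.
move=> [_ cX]; apply/funext => p; have [c Ac cp] := man_cover p.
have [a _ aE] := cX c Ac; rewrite aE //; last exact: smooth_fun_cst.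
exact: derive_cst.
Qed.

End Derivations.

(** * Maps that are linear over smooth functions *)

Section Tensoriality.
Context {R : realType} {d : nat} {M : manifold 'rV[R]_d.+1}.
Implicit Types (f h : M -> R) (X Y Z : operator M) (w : operator M -> M -> R).

Lemma smooth_vector_field X f : vector_field X -> smooth_fun f ->
  smooth_fun (X f).
Proof.
move=> [_ cX] sf c Ac n; have [a sa aE] := cX c Ac.
apply: diff_class_ext (open_img Ac) _
  (diff_class_derive_along (open_img Ac) (sa n) (sf c Ac n.+1)) => _ [p cp <-].
by rewrite /= param_coord // aE.
Qed.

(** Values are functions rather than vector fields.  A map [T] to vector
    fields is covered by taking [fun X => T X h] for each [h]. *)
Definition function_linear w := forall f X X', smooth_fun f ->
  vector_field X -> vector_field X' -> w (fscale f X + X') = f * w X + w X'.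

Lemma function_linear0 w : function_linear w -> w 0 = 0.
Proof.
move=> lw; have v0 := @vector_field0 _ _ M.
have := lw (cst (-1)) 0 0 (smooth_fun_cst _) v0 v0.
rewrite fscale0 addr0 => ->; apply/funext => p.
by rewrite !fctE mulN1r addNr.
Qed.

Lemma function_linear_fscale w f X : function_linear w -> smooth_fun f ->
  vector_field X -> w (fscale f X) = f * w X.
Proof.
move=> lw sf vX; rewrite -[fscale f X]addr0 lw //; last exact: vector_field0.
by rewrite function_linear0 // addr0.
Qed.

Lemma function_linearD w X Y : function_linear w ->
  vector_field X -> vector_field Y -> w (X + Y) = w X + w Y.
Proof.
move=> lw vX vY; rewrite -{1}[X]fscale1 lw //; last exact: smooth_fun_cst.
by congr (_ + _); exact: mul1r.
Qed.

Lemma function_linearB w X Y : function_linear w ->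
  vector_field X -> vector_field Y -> w (X - Y) = w X - w Y.
Proof.
move=> lw vX vY; rewrite addrC -scaleN1r -fscale_cst lw //; last first.
  exact: smooth_fun_cst.
by rewrite addrC; congr (_ + _); exact: mulN1r.
Qed.

(** Independence is asked of the values at [p] as functionals on global
    smooth functions, not of components in a chart: this is what left
    invariance provides and what the elimination below consumes. *)
Definition independent_at (p : M) n (X : nat -> operator M) :=
  forall c : nat -> R,
    (forall f, smooth_fun f -> \sum_(i < n) c i * X i f p = 0) ->
    forall i, (i < n)%N -> c i = 0.

(** Induction on the number of fields.  Independence gives a function [f] with
    [X 0 f p != 0]; then [X 0 f * Z - Z f * X 0] is a combination, with the
    remaining coefficients, of the fields
    [X 0 f * X i.+1 - X i.+1 f * X 0], which are independent at [p].  It also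
    vanishes at [p], so [w] kills it there; as [Z f p = 0], this says
    [X 0 f p * w Z p = 0]. *)
Lemma function_linear_vanish n (X : nat -> operator M) Z (a : M -> nat -> R)
    (p : M) w :
  function_linear w -> (forall i, (i < n)%N -> vector_field (X i)) ->
  vector_field Z -> independent_at p n X ->
  (forall f, smooth_fun f ->
     forall q, Z f q = \sum_(i < n) a q i * X i f q) ->
  (forall f, smooth_fun f -> Z f p = 0) -> w Z p = 0.
Proof.
move=> lw; elim: n X Z a => [|n IHn] X Z a vX vZ indX ZE Zp0.
  rewrite (vector_field_eq vZ (@vector_field0 _ _ M)); last first.
    by move=> f sf q; rewrite ZE // big_ord0.
  by rewrite function_linear0.
have vX0 : vector_field (X 0%N) by exact: vX.
have [f [sf Xfp]] : exists f, smooth_fun f /\ X 0%N f p != 0.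
  apply: contrapT => noX0; suff /eqP : (0%N == 0%N)%:R = 0 :> R.
    by rewrite oner_eq0.
  apply: (indX (fun i => (i == 0%N)%:R)) => // h sh.
  rewrite big_ord_recl /= big1 ?addr0 ?mul1r; last first.
    by move=> i _; rewrite mul0r.
  by apply: contrapT => /eqP Xhp; apply: noX0; exists h.
pose X' i := fscale (X 0%N f) (X i.+1) - fscale (X i.+1 f) (X 0%N).
pose Z' := fscale (X 0%N f) Z - fscale (Z f) (X 0%N).
have sX i : (i < n.+1)%N -> smooth_fun (X i f).
  by move=> lti; apply: smooth_vector_field => //; exact: vX.
have sZ : smooth_fun (Z f) by exact: smooth_vector_field.
have vX' i : (i < n)%N -> vector_field (X' i).
  by move=> lti; apply: vector_fieldB; apply: vector_field_fscale => //;
     [exact: sX|exact: vX|exact: sX].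
have vZ' : vector_field Z'.
  by apply: vector_fieldB; apply: vector_field_fscale => //; exact: sX.
have X'E i h q : X' i h q = X 0%N f q * X i.+1 h q - X i.+1 f q * X 0%N h q.
  by [].
have indX' : independent_at p n X'.
  move=> c cX' i ltin.
  pose c' j := if j is j'.+1 then c j' * X 0%N f p
               else - \sum_(k < n) c k * X k.+1 f p.
  have /(_ i.+1 ltin)/eqP : forall j, (j < n.+1)%N -> c' j = 0.
    apply: indX => h sh; rewrite big_ord_recl /= -[RHS](cX' h sh).
    rewrite mulNr mulr_suml addrC -sumrB; apply: eq_bigr => k _.
    by rewrite X'E mulrBr !mulrA.
  by rewrite mulf_eq0 (negPf Xfp) orbF => /eqP.
have Z'E h : smooth_fun h ->
    forall q, Z' h q = \sum_(i < n) a q i.+1 * X' i h q.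
  move=> sh q.
  have -> : Z' h q = X 0%N f q * Z h q - Z f q * X 0%N h q by [].
  rewrite (ZE f sf q) (ZE h sh q) !big_ord_recl mulrDr mulrDl opprD addrACA.
  rewrite [X in X + _](_ : _ = 0) ?add0r; last first.
    by rewrite mulrCA mulrA subrr.
  rewrite mulr_sumr mulr_suml -sumrB; apply: eq_bigr => i _.
  rewrite X'E mulrBr; rewrite lift0; congr (_ - _); first exact: mulrCA.
  by rewrite mulrA.
have /(congr1 (fun F => F p)) : w Z' = X 0%N f * w Z - Z f * w (X 0%N).
  rewrite function_linearB // ?function_linear_fscale //.
  - exact: sX.
  - by apply: vector_field_fscale => //; exact: sX.
  - exact: vector_field_fscale.
  have -> : w Z' p = 0.
    apply: (IHn X' Z' (fun q i => a q i.+1)) => // h sh.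
    have -> : Z' h p = X 0%N f p * Z h p - Z f p * X 0%N h p by [].
    by rewrite !Zp0 // mulr0 mul0r subr0.
move=> /esym; rewrite !fctE Zp0 // mul0r subr0 => /eqP.
by rewrite mulf_eq0 (negPf Xfp) => /eqP.
Qed.

(** Freezing the coefficients at [p] and subtracting leaves a field that
    vanishes at [p]. *)
Lemma function_linear_frame n (X : nat -> operator M) Z (a : M -> nat -> R)
    w (p : M) :
  function_linear w -> (forall i, (i < n)%N -> vector_field (X i)) ->
  vector_field Z -> independent_at p n X ->
  (forall f, smooth_fun f ->
     forall q, Z f q = \sum_(i < n) a q i * X i f q) ->
  w Z p = \sum_(i < n) a p i * w (X i) p.
Proof.
move=> lw vX vZ indX ZE.
pose S k := \sum_(i < k) fscale (cst (a p i)) (X i).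
have vS k : (k <= n)%N -> vector_field (S k).
  move=> lekn; apply: (@vector_field_sum _ _ _ _ X (fun i => cst (a p i))).
    by move=> i ltik; apply: vX; exact: leq_trans lekn.
  by move=> i _; exact: smooth_fun_cst.
have wS k : (k <= n)%N -> w (S k) p = \sum_(i < k) a p i * w (X i) p.
  elim: k => [|k IHk] lekn.
    by rewrite /S !big_ord0 function_linear0.
  rewrite /S big_ord_recr /= addrC lw //; last 3 first.
  - exact: smooth_fun_cst.
  - exact: vX.
  - by apply: vS; exact: ltnW.
  by rewrite big_ord_recr /= -IHk ?(ltnW lekn)// addrC.
have SE f k q : S k f q = \sum_(i < k) a p i * X i f q.
  elim: k => [|k IHk]; first by rewrite /S !big_ord0.
  by rewrite /S !big_ord_recr /= -IHk.
rewrite -(wS n) //; apply/eqP; rewrite -subr_eq0; apply/eqP.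
have -> : w Z p - w (S n) p = w (Z - S n) p.
  by rewrite function_linearB //; exact: vS.
apply: (@function_linear_vanish n X _ (fun q i => a q i - a p i)) => //.
- by apply: vector_fieldB => //; exact: vS.
- move=> f sf q; have -> : (Z - S n) f q = Z f q - S n f q by [].
  by rewrite ZE // SE -sumrB; apply: eq_bigr => i _; rewrite mulrBl.
- move=> f sf; have -> : (Z - S n) f p = Z f p - S n f p by [].
  by rewrite ZE // SE subrr.
Qed.

End Tensoriality.

(** * Linear connections and their curvature *)

Section Connections.
Context {R : realType} {d : nat} {M : manifold 'rV[R]_d.+1}.
Context (nabla : connection M) (nabla_lin : linear_connection nabla).
Implicit Types (f h : M -> R) (X Y Z U : operator M).

Lemma nabla_field X Y : vector_field X -> vector_field Y ->
  vector_field (nabla X Y).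
Proof. by case: nabla_lin => + _ _ _; apply. Qed.

Lemma nablaZDl f X X' Y : smooth_fun f -> vector_field X -> vector_field X' ->
  vector_field Y ->
  nabla (fscale f X + X') Y = fscale f (nabla X Y) + nabla X' Y.
Proof. by case: nabla_lin => _ + _ _; apply. Qed.

Lemma nablaZDr f X Y Y' : smooth_fun f -> vector_field X -> vector_field Y ->
  vector_field Y' ->
  nabla X (fscale f Y + Y') =
  fscale (X f) Y + (fscale f (nabla X Y) + nabla X Y').
Proof.
case: nabla_lin => _ _ nablaD nablaZ sf vX vY vY'.
rewrite nablaD //; first by rewrite nablaZ // addrA.
exact: vector_field_fscale.
Qed.

Lemma nabla_function_linear Y h : vector_field Y ->
  function_linear (fun X => nabla X Y h).
Proof. by move=> vY f X X' sf vX vX'; rewrite nablaZDl. Qed.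

Lemma nabla0l Y : vector_field Y -> nabla 0 Y = 0.
Proof.
move=> vY; apply/funext => h.
exact: function_linear0 (nabla_function_linear h vY).
Qed.

Lemma nablaZl r X Y : vector_field X -> vector_field Y ->
  nabla (r *: X) Y = r *: nabla X Y.
Proof.
move=> vX vY; have := nablaZDl (smooth_fun_cst r) vX vector_field0 vY.
by rewrite nabla0l // !addr0.
Qed.

Lemma nablaNl X Y : vector_field X -> vector_field Y ->
  nabla (- X) Y = - nabla X Y.
Proof. by move=> vX vY; rewrite -[- X]scaleN1r nablaZl // scaleN1r. Qed.

Lemma nablaDl X X' Y : vector_field X -> vector_field X' -> vector_field Y ->
  nabla (X + X') Y = nabla X Y + nabla X' Y.
Proof.
move=> vX vX' vY; have := nablaZDl (smooth_fun_cst 1) vX vX' vY.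
by rewrite !fscale1.
Qed.

Lemma nablaDr X Y Y' : vector_field X -> vector_field Y -> vector_field Y' ->
  nabla X (Y + Y') = nabla X Y + nabla X Y'.
Proof. by case: nabla_lin => _ _ + _; apply. Qed.

Lemma nablaZr r X Y : vector_field X -> vector_field Y ->
  nabla X (r *: Y) = r *: nabla X Y.
Proof.
move=> vX vY; case: nabla_lin => _ _ _ nablaZ.
rewrite -fscale_cst nablaZ //; last exact: smooth_fun_cst.
rewrite vector_field_cstf //; apply/funext => h; apply/funext => p.
by rewrite [LHS]addrC [X in _ + X]mul0r addr0.
Qed.

Lemma nabla0r X : vector_field X -> nabla X 0 = 0.
Proof.
by move=> vX; rewrite -(scale0r (0 : operator M)) nablaZr ?scale0r //;
   exact: vector_field0.
Qed.

Lemma lie_bracketC X Y : lie_bracket Y X = - lie_bracket X Y.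
Proof. by apply/funext => h; rewrite /lie_bracket -[LHS]opprB. Qed.

(** The Leibniz rule of the bracket.  The brackets are assumed to be vector
    fields so that it suffices to compare them on smooth functions. *)
Lemma lie_bracketZDl f X X' U : smooth_fun f ->
  vector_field X -> vector_field X' -> vector_field U ->
  vector_field (lie_bracket (fscale f X + X') U) ->
  vector_field (lie_bracket X U) -> vector_field (lie_bracket X' U) ->
  lie_bracket (fscale f X + X') U =
  fscale f (lie_bracket X U) + (fscale (- U f) X + lie_bracket X' U).
Proof.
move=> sf vX vX' vU vB vXU vX'U; have sUf := smooth_vector_field vU sf.
apply: vector_field_eq => //.
  by do 2![apply: vector_fieldZD => //]; exact: smooth_funN.
move=> h sh p; have sXh := smooth_vector_field vX sh.
have sX'h := smooth_vector_field vX' sh.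
have E : U ((fscale f X + X') h) = U f * X h + f * U (X h) + U (X' h).
  rewrite (_ : (fscale f X + X') h = f * X h + X' h) //.
  by rewrite (vector_field_addf vU (smooth_funM sf sXh) sX'h)
             (vector_field_mulf vU sf sXh).
have -> : lie_bracket (fscale f X + X') U h p =
  f p * X (U h) p + X' (U h) p - U ((fscale f X + X') h) p by [].
rewrite E /fscale /lie_bracket !fctE.
ring.
Qed.

Lemma curvatureC X U Z : vector_field X -> vector_field U -> vector_field Z ->
  vector_field (lie_bracket X U) ->
  curvature nabla U X Z = - curvature nabla X U Z.
Proof.
move=> vX vU vZ vB; rewrite /curvature lie_bracketC nablaNl // opprK.
by rewrite opprB opprB addrC.
Qed.

Lemma curvatureXX X Z : vector_field Z -> curvature nabla X X Z = 0.
Proof.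
move=> vZ; rewrite /curvature.
have -> : lie_bracket X X = 0 by apply/funext => h; exact: subrr.
by rewrite nabla0l // subr0 subrr.
Qed.

Context (bracket_field : forall X Y : operator M,
  vector_field X -> vector_field Y -> vector_field (lie_bracket X Y)).

(** The terms in [X f] and [U f] cancel in pairs, and the second derivatives
    [X (U f) - U (X f)] cancel against the derivative along the bracket. *)
Lemma curvature_function_linear_arg X U h : vector_field X ->
  vector_field U -> function_linear (fun Z => curvature nabla X U Z h).
Proof.
move=> vX vU f Z Z' sf vZ vZ'; rewrite /curvature.
have vB := bracket_field vX vU.
have [sUf sXf] := (smooth_vector_field vU sf, smooth_vector_field vX sf).
have nf := nabla_field; have vE Y : vector_field Y -> forall W, vector_field W ->
  vector_field (fscale f (nabla Y Z) + nabla W Z').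
  by move=> vY W vW; apply: vector_fieldZD => //; exact: nf.
rewrite !nablaZDr //; try by [exact: nf|exact: vE].
by apply/funext => p; rewrite /fscale /lie_bracket !fctE; ring.
Qed.

(** The term in [U f] from differentiating [f * nabla X Z] cancels against the
    one from the Leibniz rule of the bracket. *)
Lemma curvature_function_linear_field U Z h : vector_field U ->
  vector_field Z -> function_linear (fun X => curvature nabla X U Z h).
Proof.
move=> vU vZ f X X' sf vX vX'; rewrite /curvature.
have vXX' := vector_fieldZD sf vX vX'; have nf := nabla_field.
have sUf := smooth_vector_field vU sf.
have [vB vB'] := (bracket_field vX vU, bracket_field vX' vU).
rewrite lie_bracketZDl //; last exact: bracket_field.
have sNUf := smooth_funN sUf; have vW := vector_fieldZD sNUf vX vB'.
rewrite !nablaZDl // ?nablaZDr //; try exact: nf.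
by apply/funext => p; rewrite /fscale !fctE; ring.
Qed.

End Connections.

(** * Left-invariant frames *)

Section LeftInvariantFrames.
Context {R : realType} {G : lieGroup 'rV[R]_3}.
Implicit Types (X Y Z : operator G) (f h : G -> R).

(** The group axioms are given on the left only. *)
Lemma lg_mul1r (x : G) : lg_mul x (lg_one G) = x.
Proof.
have mulxV (y : G) : lg_mul y (lg_inv y) = lg_one G.
  rewrite -[LHS]lg_mul1 -{1}(lg_mulV (lg_inv y)) -lg_mulA.
  by rewrite [lg_mul (lg_inv y) _]lg_mulA lg_mulV lg_mul1 lg_mulV.
by rewrite -(lg_mulV x) lg_mulA mulxV lg_mul1.
Qed.

(** Translate any point to [p].  If the translate of [f] by [lg_mul a] were
    not smooth, [X] would still vanish on it, since vector fields are zero off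
    the smooth functions. *)
Lemma left_invariant_eq0 X (p : G) : vector_field X -> left_invariant X ->
  (forall f, smooth_fun f -> X f p = 0) -> X = 0.
Proof.
move=> vX lX Xp0; apply: (vector_field_eq vX vector_field0) => f sf q.
pose a := lg_mul q (lg_inv p).
have aE : lg_mul a p = q by rewrite /a -lg_mulA lg_mulV lg_mul1r.
have <- : X (f \o lg_mul a) p = X f q by rewrite lX //= aE.
have [sfa|nsfa] := pselect (smooth_fun (f \o lg_mul a)); first exact: Xp0.
by case: vX => ->.
Qed.

(** A relation at [p] is a left-invariant field vanishing at [p], hence zero,
    and the expansion of zero in the basis is unique. *)
Lemma lie_algebra_basis_independent (e1 e2 e3 : operator G) (p : G) :
  lie_algebra_basis e1 e2 e3 -> independent_at p 3 (nth 0 [:: e1; e2; e3]).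
Proof.
move=> [[v1 l1] [v2 l2] [v3 l3] basis] c cE.
pose X := c 0%N *: e1 + c 1%N *: e2 + c 2%N *: e3.
have vX : vector_field X.
  by do ![apply: vector_fieldD]; exact: vector_fieldZ.
have lX : left_invariant X.
  move=> a f sf; have E h : X h = c 0%N *: e1 h + c 1%N *: e2 h + c 2%N *: e3 h.
    by [].
  by rewrite !E l1 // l2 // l3.
have X0 : X = 0.
  apply: (left_invariant_eq0 (p := p)) => // f sf.
  by rewrite -[RHS](cE f sf) !big_ord_recl big_ord0 addr0 addrA.
have l0 : left_invariant (0 : operator G) by [].
have [abc [_ abc_uniq]] := basis 0 vector_field0 l0.
have E0 : abc = (0, 0, 0).
  by apply: abc_uniq; rewrite /= !scale0r !addr0.
have : abc = (c 0%N, c 1%N, c 2%N) by apply: abc_uniq; rewrite -X0.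
by rewrite E0 => -[c0 c1 c2] [|[|[|]]].
Qed.

End LeftInvariantFrames.

(** * Orthonormal frames adapted to the splitting *)

Section OrthonormalFrame.
Context {R : realType} {G : lieGroup 'rV[R]_3}.
Context (g : form2 G) (g_tensor : tensor02 g).
Context (g_sym : forall X Y : operator G,
  vector_field X -> vector_field Y -> g X Y = g Y X).
Context (e1 e2 e3 : operator G) (e_basis : lie_algebra_basis e1 e2 e3).
Context (g11 : g e1 e1 = cst 1) (g22 : g e2 e2 = cst 1).
Context (g33 : g e3 e3 = cst (-1)).
Context (g12 : g e1 e2 = cst 0) (g13 : g e1 e3 = cst 0) (g23 : g e2 e3 = cst 0).
Context (pi_D pi_Dperp : operator G -> operator G).
Context (pi_split : splitting_projections [:: e1; e2] [:: e3] pi_D pi_Dperp).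
Implicit Types (X Y Z : operator G) (f h : G -> R).

Lemma frame_field1 : vector_field e1. Proof. by case: e_basis => -[]. Qed.
Lemma frame_field2 : vector_field e2. Proof. by case: e_basis => _ -[]. Qed.
Lemma frame_field3 : vector_field e3. Proof. by case: e_basis => _ _ -[]. Qed.
Hint Resolve frame_field1 frame_field2 frame_field3 : core.

Lemma metric_function_linear Y : vector_field Y -> function_linear (g^~ Y).
Proof.
by move=> vY f X X' sf vX vX'; case: g_tensor => _ /(_ f X X' Y)[].
Qed.

Lemma metric_smooth X Y : vector_field X -> vector_field Y ->
  smooth_fun (g X Y).
Proof. by case: g_tensor => + _; apply. Qed.

(** The coefficients are arbitrary functions here; they turn out to be
    smooth, being products with the frame.  The sign in the third one comes
    from [e3] being timelike. *)
Lemma frame_pointwise X (a b c : G -> R) : vector_field X ->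
  (forall f, smooth_fun f ->
     forall p, X f p = a p * e1 f p + b p * e2 f p + c p * e3 f p) ->
  [/\ g X e1 = a, g X e2 = b & - g X e3 = c].
Proof.
move=> vX XE.
have E Y p : vector_field Y ->
    g X Y p = a p * g e1 Y p + b p * g e2 Y p + c p * g e3 Y p.
  move=> vY; rewrite (@function_linear_frame _ _ _ 3 (nth 0 [:: e1; e2; e3]) X
    (fun q => nth 0 [:: a q; b q; c q]) _ p (metric_function_linear vY)) //.
  - by rewrite !big_ord_recl big_ord0 addr0 addrA.
  - by move=> [|[|[|]]].
  - exact: lie_algebra_basis_independent.
  - by move=> f sf q; rewrite !big_ord_recl big_ord0 addr0 addrA; exact: XE.
have [g21 g31 g32] : [/\ g e2 e1 = cst 0, g e3 e1 = cst 0 & g e3 e2 = cst 0].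
  by split; rewrite g_sym.
split; apply/funext => p.
- by rewrite E // g11 g21 g31 /= !mulr0 !addr0 mulr1.
- by rewrite E // g12 g22 g32 /= !mulr0 addr0 add0r mulr1.
- rewrite (_ : (- g X e3) p = - (g X e3 p)) // E // g13 g23 g33 /=.
  by ring.
Qed.

Lemma section_perp_pointwise X : sections [:: e3] X ->
  exists c : G -> R, forall f, smooth_fun f -> forall p, X f p = c p * e3 f p.
Proof.
move=> [_ /choice[c cE]]; exists (fun p => c p 0%N) => f sf p.
by rewrite cE // big_ord_recl big_ord0 addr0.
Qed.

Lemma section_pointwise X : sections [:: e1; e2] X ->
  exists a : G -> R, exists b : G -> R,
    forall f, smooth_fun f -> forall p, X f p = a p * e1 f p + b p * e2 f p.
Proof.
move=> [_ /choice[c cE]]; exists (c^~ 0%N), (c^~ 1%N) => f sf p.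
by rewrite cE // !big_ord_recl big_ord0 addr0.
Qed.

Lemma frame_expansion X : vector_field X ->
  X = fscale (g X e1) e1 + (fscale (g X e2) e2 + fscale (- g X e3) e3).
Proof.
move=> vX; have [s1 s2 XE] := pi_split vX.
have [a [b abE]] := section_pointwise s1; have [c cE] := section_perp_pointwise s2.
have XE' f (sf : smooth_fun f) p :
    X f p = a p * e1 f p + b p * e2 f p + c p * e3 f p.
  by rewrite -abE // -cE // {1}XE.
have [-> -> ->] := frame_pointwise vX XE'.
apply/funext => f; have [sf|nsf] := pselect (smooth_fun f).
  by apply/funext => p; rewrite XE' // /fscale !fctE addrA.
have [[X0 _] [e10 _]] := (vX, frame_field1).
have [[e20 _] [e30 _]] := (frame_field2, frame_field3).
apply/funext => p; rewrite /fscale !fctE X0 // e10 // e20 // e30 //.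
have zeroE (x y z : R) : 0 = x * 0 + (y * 0 + z * 0) by ring.
exact: zeroE.
Qed.

Lemma function_linear_expansion (w : operator G -> G -> R) X :
  function_linear w -> vector_field X ->
  w X = g X e1 * w e1 + (g X e2 * w e2 - g X e3 * w e3).
Proof.
move=> lw vX; rewrite {1}(frame_expansion vX).
have sm := metric_smooth; have sN : smooth_fun (- g X e3).
  by apply: smooth_funN; exact: sm.
have v3 := vector_field_fscale sN frame_field3.
rewrite lw //; [|exact: sm|by apply: vector_fieldZD => //; exact: sm].
rewrite lw //; [|exact: sm].
by rewrite function_linear_fscale // mulNr.
Qed.

Lemma projections_expansion X : vector_field X ->
  pi_D X = fscale (g X e1) e1 + fscale (g X e2) e2 /\
  pi_Dperp X = fscale (- g X e3) e3.
Proof.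
move=> vX; have [s1 s2 XE] := pi_split vX; have [v1 _] := s1; have [v2 _] := s2.
have [a [b abE]] := section_pointwise s1; have [c cE] := section_perp_pointwise s2.
have [D1 D2 D3] : [/\ g (pi_D X) e1 = a, g (pi_D X) e2 = b &
    - g (pi_D X) e3 = cst 0].
  by apply: frame_pointwise => // f sf p; rewrite abE // mul0r addr0.
have [P1 P2 P3] : [/\ g (pi_Dperp X) e1 = cst 0, g (pi_Dperp X) e2 = cst 0 &
    - g (pi_Dperp X) e3 = c].
  by apply: frame_pointwise => // f sf p; rewrite cE // !mul0r !add0r.
have gX Y : vector_field Y -> g X Y = g (pi_D X) Y + g (pi_Dperp X) Y.
  move=> vY; rewrite {1}XE; apply: (function_linearD (w := g^~ Y)) => //.
  exact: metric_function_linear.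
have f0 Y : fscale (cst 0) Y = 0 by rewrite fscale_cst scale0r.
have c0 (F : G -> R) : F + cst 0 = F by exact: addr0.
split.
  by rewrite (frame_expansion v1) D3 f0 addr0 !gX // P1 P2 !c0.
rewrite (frame_expansion v2) P1 P2 !f0 !add0r gX // opprD D3.
by congr (fscale _ _); rewrite [RHS]add0r.
Qed.

Context (nablaL : connection G) (nablaL_levi_civita : levi_civita g nablaL).

(** The torsion of the Levi-Civita connection vanishes, so the bracket is a
    difference of covariant derivatives. *)
Lemma lie_bracket_field X Y : vector_field X -> vector_field Y ->
  vector_field (lie_bracket X Y).
Proof.
move=> vX vY; case: nablaL_levi_civita => linL torL _.
have -> : lie_bracket X Y = nablaL X Y - nablaL Y X.
  by apply/esym/eqP; rewrite -subr_eq0; apply/eqP; exact: torL.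
by apply: vector_fieldB; exact: nabla_field.
Qed.

Lemma levi_civita_skew X Y Z r : vector_field X -> vector_field Y ->
  vector_field Z -> g Y Z = cst r -> g (nablaL X Y) Z = - g (nablaL X Z) Y.
Proof.
move=> vX vY vZ gYZ; case: nablaL_levi_civita => linL _ metL.
have := metL X Y Z vX vY vZ; rewrite /cov_deriv gYZ vector_field_cstf //.
rewrite sub0r (g_sym vY (nabla_field linL vX vZ)) => /eqP.
by rewrite subr_eq0 => /eqP <-; rewrite opprK.
Qed.

Lemma levi_civita_unit X Y r : vector_field X -> vector_field Y ->
  g Y Y = cst r -> g (nablaL X Y) Y = 0.
Proof.
move=> vX vY gYY; have := levi_civita_skew vX vY vY gYY.
move=> E; apply/funext => p; have /(congr1 (fun F => F p)) := E.
move=> /eqP; rewrite [X in _ == X](_ : _ = - (g (nablaL X Y) Y p)) //.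
by rewrite eq_sym eqNr => /eqP.
Qed.

Context (alpha beta gamma delta : R).
Context (e12 : lie_bracket e1 e2 = 0).
Context (e13 : lie_bracket e1 e3 = alpha *: e1 + beta *: e2).
Context (e23 : lie_bracket e2 e3 = gamma *: e1 + delta *: e2).

(** The Koszul relations.  Write [Gijk] for [g (nablaL ei ej) ek], with
    indices 1 and 2: it is skew in [j, k] because the frame has constant
    products, and symmetric in [i, j] because [e1] and [e2] commute, so it
    vanishes. *)
Lemma levi_civita_leaf_flat i j :
  (i < 2)%N -> (j < 2)%N ->
  pi_D (nablaL (nth 0 [:: e1; e2] i) (nth 0 [:: e1; e2] j)) = 0.
Proof.
case: nablaL_levi_civita => linL torL _.
have sym12 : nablaL e1 e2 = nablaL e2 e1.
  have := torL e1 e2 frame_field1 frame_field2.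
  by rewrite /torsion e12 subr0 => /eqP; rewrite subr_eq0 => /eqP.
have G111 := levi_civita_unit frame_field1 frame_field1 g11.
have G211 := levi_civita_unit frame_field2 frame_field1 g11.
have G122 := levi_civita_unit frame_field1 frame_field2 g22.
have G222 := levi_civita_unit frame_field2 frame_field2 g22.
have G121 : g (nablaL e1 e2) e1 = 0 by rewrite sym12.
have G212 : g (nablaL e2 e1) e2 = 0 by rewrite -sym12.
have g21 : g e2 e1 = cst 0 by rewrite g_sym.
have G112 : g (nablaL e1 e1) e2 = 0.
  by rewrite (levi_civita_skew frame_field1 frame_field1 frame_field2 g12) G121
     oppr0.
have G221 : g (nablaL e2 e2) e1 = 0.
  by rewrite (levi_civita_skew frame_field2 frame_field2 frame_field1 g21) G212
     oppr0.
have f0 Y : fscale (0 : G -> R) Y = 0 by rewrite (fscale_cst 0) scale0r.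
have flat X : vector_field X -> g X e1 = 0 -> g X e2 = 0 -> pi_D X = 0.
  by move=> vX gX1 gX2; have [-> _] := projections_expansion vX;
     rewrite gX1 gX2 !f0 addr0.
by move: i j => [|[|//]] [|[|//]] _ _ /=; apply: flat => //; exact: nabla_field.
Qed.

(** ** The Bott connection in the frame *)

Context (nablaB : connection G).
Context (nablaB_bott :
  bott_connection [:: e1; e2] [:: e3] pi_D pi_Dperp nablaL nablaB).

Lemma section_frame1 : sections [:: e1; e2] e1.
Proof.
split=> // p; exists (fun i => (i == 0%N)%:R) => f sf.
by rewrite !big_ord_recl big_ord0 /= mul0r !addr0 mul1r.
Qed.

Lemma section_frame2 : sections [:: e1; e2] e2.
Proof.
split=> // p; exists (fun i => (i == 1%N)%:R) => f sf.
by rewrite !big_ord_recl big_ord0 /= mul0r addr0 add0r mul1r.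
Qed.

Lemma section_frame3 : sections [:: e3] e3.
Proof.
split=> // p; exists (fun i => 1) => f sf.
by rewrite !big_ord_recl big_ord0 /= addr0 mul1r.
Qed.

Lemma leaf_field r s : vector_field (r *: e1 + s *: e2).
Proof. by apply: vector_fieldD; exact: vector_fieldZ. Qed.

Lemma projections_leaf r s :
  pi_D (r *: e1 + s *: e2) = r *: e1 + s *: e2 /\
  pi_Dperp (r *: e1 + s *: e2) = 0.
Proof.
have vX := leaf_field r s.
have [g1 g2 g3] : [/\ g (r *: e1 + s *: e2) e1 = cst r,
    g (r *: e1 + s *: e2) e2 = cst s & - g (r *: e1 + s *: e2) e3 = cst 0].
  by apply: frame_pointwise => // f sf p; rewrite mul0r addr0.
have [-> ->] := projections_expansion vX.
by rewrite g1 g2 g3 !fscale_cst scale0r.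
Qed.

(** For [k = 2], that is [e3], the value is the transverse part of the bracket
    with [e3], and that bracket lies in the leaf directions. *)
Lemma bott_leaf i k : (i < 2)%N -> (k < 3)%N ->
  nablaB (nth 0 [:: e1; e2] i) (nth 0 [:: e1; e2; e3] k) = 0.
Proof.
have [linB [bottDD bottND bottDN _]] := nablaB_bott.
have [[s1 s2] s3] := (section_frame1, section_frame2, section_frame3).
have sD j : (j < 2)%N -> sections [:: e1; e2] (nth 0 [:: e1; e2] j).
  by case: j => [|[|j]] /=.
move=> lti; case: k => [|[|[|//]]] _ /=.
- by rewrite bottDD //; [exact: (@levi_civita_leaf_flat i 0)|exact: sD].
- by rewrite bottDD //; [exact: (@levi_civita_leaf_flat i 1)|exact: sD].
- rewrite bottDN //; last exact: sD.
  by case: i lti => [|[|//]] _ /=; rewrite ?e13 ?e23;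
     have [] := projections_leaf alpha beta; have [] := projections_leaf gamma delta.
Qed.

Lemma bott_transverse k : (k < 3)%N ->
  exists r s, nablaB e3 (nth 0 [:: e1; e2; e3] k) = r *: e1 + s *: e2.
Proof.
have [linB [_ bottND _ bottNN]] := nablaB_bott.
have [[s1 s2] s3] := (section_frame1, section_frame2, section_frame3).
have leafN r s : - (r *: e1 + s *: e2) = (- r) *: e1 + (- s) *: e2.
  by rewrite opprD !scaleNr.
case: k => [|[|[|//]]] _ /=.
- exists (- alpha), (- beta); rewrite bottND // lie_bracketC e13 leafN.
  by have [] := projections_leaf (- alpha) (- beta).
- exists (- gamma), (- delta); rewrite bottND // lie_bracketC e23 leafN.
  by have [] := projections_leaf (- gamma) (- delta).
- exists 0, 0; rewrite bottNN // !scale0r addr0.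
  case: nablaL_levi_civita => linL _ _.
  have vX := nabla_field linL frame_field3 frame_field3.
  have [_ ->] := projections_expansion vX.
  rewrite (levi_civita_unit frame_field3 frame_field3 g33) oppr0.
  by rewrite (fscale_cst 0) scale0r.
Qed.

Lemma bott_leaf_direction Z k : (k < 3)%N ->
  (exists r s, Z = r *: e1 + s *: e2) ->
  nablaB Z (nth 0 [:: e1; e2; e3] k) = 0.
Proof.
move=> ltk [r [s ->]]; have [linB _] := nablaB_bott.
have vk : vector_field (nth 0 [:: e1; e2; e3] k) by case: k ltk => [|[|[|]]].
have v1 := vector_fieldZ r frame_field1; have v2 := vector_fieldZ s frame_field2.
rewrite (nablaDl linB) // !(nablaZl linB) //.
have /= -> := bott_leaf (i := 0) isT ltk; have /= -> := bott_leaf (i := 1) isT ltk.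
by rewrite !scaler0 addr0.
Qed.

Lemma bott_leaf_argument i Z : (i < 2)%N ->
  (exists r s, Z = r *: e1 + s *: e2) ->
  nablaB (nth 0 [:: e1; e2] i) Z = 0.
Proof.
move=> lti [r [s ->]]; have [linB _] := nablaB_bott.
have vi : vector_field (nth 0 [:: e1; e2] i) by case: i lti => [|[|]].
have v1 := vector_fieldZ r frame_field1; have v2 := vector_fieldZ s frame_field2.
rewrite (nablaDr linB) // !(nablaZr linB) //.
have /= -> := bott_leaf (k := 0) lti isT; have /= -> := bott_leaf (k := 1) lti isT.
by rewrite !scaler0 addr0.
Qed.

(** Of the three terms, the first differentiates a constant combination of
    [e1] and [e2] along a leaf, the second differentiates zero, and the third
    differentiates along a bracket that is a leaf direction. *)
Lemma bott_curvature_leaf_transverse i k : (i < 2)%N -> (k < 3)%N ->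
  curvature nablaB (nth 0 [:: e1; e2] i) e3 (nth 0 [:: e1; e2; e3] k) = 0.
Proof.
move=> lti ltk; have [linB _] := nablaB_bott.
rewrite /curvature (bott_leaf lti ltk) (nabla0r linB) // subr0.
rewrite (bott_leaf_argument lti (bott_transverse ltk)) bott_leaf_direction //.
  by rewrite subrr.
by case: i lti => [|[|//]] _ /=; rewrite ?e13 ?e23;
   [exists alpha, beta|exists gamma, delta].
Qed.

Lemma bott_curvature_frame i j k : (i < 3)%N -> (j < 3)%N -> (k < 3)%N ->
  curvature nablaB (nth 0 [:: e1; e2; e3] i) (nth 0 [:: e1; e2; e3] j)
    (nth 0 [:: e1; e2; e3] k) = 0.
Proof.
move=> lti ltj ltk; have [linB _] := nablaB_bott.
have vk : vector_field (nth 0 [:: e1; e2; e3] k) by case: k ltk => [|[|[|]]].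
have vB := lie_bracket_field.
have C13 := bott_curvature_leaf_transverse (isT : (0 < 2)%N) ltk.
have C23 := bott_curvature_leaf_transverse (isT : (1 < 2)%N) ltk.
have C12 : curvature nablaB e1 e2 (nth 0 [:: e1; e2; e3] k) = 0.
  rewrite /curvature e12.
  have /= -> := bott_leaf (i := 0) isT ltk; have /= -> := bott_leaf (i := 1) isT ltk.
  by rewrite !(nabla0r linB) // (nabla0l linB) // !subr0.
move: i j lti ltj => [|[|[|//]]] [|[|[|//]]] _ _ /=; rewrite ?(curvatureXX linB) //.
- by rewrite (curvatureC linB) ?C12 ?oppr0 //; exact: vB.
- by rewrite (curvatureC linB) ?C13 ?oppr0 //; exact: vB.
- by rewrite (curvatureC linB) ?C23 ?oppr0 //; exact: vB.
Qed.

(** Expand the three arguments in the frame; the middle one is reached through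
    the skew-symmetry of the curvature in its first two. *)
Lemma bott_flat X Y Z : vector_field X -> vector_field Y -> vector_field Z ->
  curvature nablaB X Y Z = 0.
Proof.
move=> vX vY vZ; have [linB _] := nablaB_bott; have vB := lie_bracket_field.
have expand w W : function_linear w -> vector_field W ->
    (forall i, (i < 3)%N -> w (nth 0 [:: e1; e2; e3] i) = 0) -> w W = 0.
  move=> lw vW w0; rewrite (function_linear_expansion lw vW).
  by rewrite (w0 0%N) // (w0 1%N) // (w0 2%N) // !mulr0 subr0 addr0.
have ve i : (i < 3)%N -> vector_field (nth 0 [:: e1; e2; e3] i).
  by case: i => [|[|[|]]].
apply/funext => h.
apply: (expand (fun Z => curvature nablaB X Y Z h)) => // [|k ltk].
  exact: curvature_function_linear_arg.
apply: (expand (fun X => curvature nablaB X Y _ h)) => // [|i lti].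
  by apply: curvature_function_linear_field => //; exact: ve.
have [vi vk] := (ve _ lti, ve _ ltk).
rewrite (curvatureC linB vY vi vk (vB _ _ vY vi)).
suff -> : curvature nablaB Y (nth 0 [:: e1; e2; e3] i)
    (nth 0 [:: e1; e2; e3] k) = 0 by rewrite oppr0.
apply/funext => {}h.
apply: (expand (fun Y => curvature nablaB Y _ _ h)) => // [|j ltj].
  exact: curvature_function_linear_field.
by rewrite bott_curvature_frame.
Qed.

End OrthonormalFrame.

Unset Implicit Arguments.
Set Strict Implicit.

Theorem theorem3p6 (R : realType) (alpha beta gamma delta : R)
    (h_trace : alpha + delta <> 0)
    (h_orth : alpha * gamma + beta * delta = 0)
    (G5 : lieGroup 'rV[R]_3)
    (G5_connected : connected [set: G5])
    (G5_simply_connected : simply_connected R G5)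
    (g : form2 G5)
    (g_lorentzian : lorentzian_metric g)
    (g_left_invariant : left_invariant_metric g)
    (e1 e2 e3 : operator G5)
    (e_basis : lie_algebra_basis e1 e2 e3)
    (g11 : g e1 e1 = cst 1) (g22 : g e2 e2 = cst 1) (g33 : g e3 e3 = cst (-1))
    (g12 : g e1 e2 = cst 0) (g13 : g e1 e3 = cst 0) (g23 : g e2 e3 = cst 0)
    (e12 : lie_bracket e1 e2 = 0)
    (e13 : lie_bracket e1 e3 = alpha *: e1 + beta *: e2)
    (e23 : lie_bracket e2 e3 = gamma *: e1 + delta *: e2)
    (nablaL : connection G5)
    (nablaL_levi_civita : levi_civita g nablaL)
    (pi_D pi_Dperp : operator G5 -> operator G5)
    (pi_split : splitting_projections [:: e1; e2] [:: e3] pi_D pi_Dperp)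
    (nablaB : connection G5)
    (nablaB_bott :
      bott_connection [:: e1; e2] [:: e3] pi_D pi_Dperp nablaL nablaB) :
  quasi_statistical nablaB (sym_ricci g e1 e2 e3 nablaB).
Proof.
have [g_tensor g_sym _] := g_lorentzian; have [linB _] := nablaB_bott.
have [[v1 _] [v2 _] [v3 _] _] := e_basis.
have flat X Y Z : vector_field X -> vector_field Y -> vector_field Z ->
    curvature nablaB X Y Z = 0.
  exact: (bott_flat g_tensor g_sym e_basis g11 g22 g33 g12 g13 g23 pi_split
    nablaL_levi_civita e12 e13 e23 nablaB_bott).
have g0 Y : vector_field Y -> g 0 Y = 0.
  by move=> vY; apply: (function_linear0 (w := g^~ Y));
     exact: metric_function_linear.
have ricci0 X Y : vector_field X -> vector_field Y ->
    ricci g e1 e2 e3 nablaB X Y = 0.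
  by move=> vX vY; rewrite /ricci !flat // !g0 // subr0 oppr0 addr0.
have rho0 X Y : vector_field X -> vector_field Y ->
    sym_ricci g e1 e2 e3 nablaB X Y = 0.
  by move=> vX vY; rewrite /sym_ricci !ricci0 // addr0 scaler0.
split => //.
  split=> [X Y vX vY|f X X' Y sf vX vX' vY].
    by rewrite rho0 //; exact: (smooth_fun_cst (0 : R)).
  have vW := vector_fieldZD sf vX vX'.
  by rewrite !rho0 // mulr0 addr0.
move=> X Y Z vX vY vZ; have nf := nabla_field linB.
have vT : vector_field (torsion nablaB X Y).
  apply: vector_fieldB; first by apply: vector_fieldB; exact: nf.
  exact: (lie_bracket_field nablaL_levi_civita).
have d0 W : vector_field W -> W 0 = 0 by exact: (vector_field_cstf 0).
have cov0 U W Z' : vector_field U -> vector_field W -> vector_field Z' ->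
    cov_deriv nablaB (sym_ricci g e1 e2 e3 nablaB) U W Z' = 0.
  move=> vU vW vZ'; rewrite /cov_deriv (rho0 _ _ vW vZ').
  rewrite (rho0 _ _ (nf _ _ vU vW) vZ') (rho0 _ _ vW (nf _ _ vU vZ')) d0 //.
  by rewrite !subr0.
by rewrite !cov0 // rho0 // subr0 addr0.
Qed.
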